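(* Let $n>1$ be an odd integer. Then $2^{\omega_{\mathrm o}(n)}$ divides $\sigma(n)$, and moreover $$\frac{T(n)}{n} < \left(\frac34\right)^{\omega_{\mathrm o}(n)} E(n).$$
   Context: $\sigma(n)=\sum_{d\mid n} d$ is the sum-of-divisors function and $v_p(n)$ is the exponent of the prime $p$ in $n$. For an odd positive integer $n$: $T(n) := \sigma(n)/2^{v_2(\sigma(n))}$ is the odd part of $\sigma(n)$; $\omega_{\mathrm o}(n) := \#\{p \text{ prime} : v_p(n) \text{ is odd}\}$; and $E(n) := \prod \frac{p}{p-1}$, the product being over the primes $p\mid n$ for which $v_p(n)$ is even (so $v_p(n)\ge 2$), with $E(n)=1$ if there are no such primes. *)

(* Defs.v *)
From mathcomp Require Import all_boot all_order all_algebra.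

Set Implicit Arguments.
Unset Strict Implicit.
Unset Printing Implicit Defensive.

Import GRing.Theory.

(* All definitions below are only meant for [0 < n]: mathcomp sets
   [divisors 0 = [:: 1]] and [primes 0 = [::]]. *)

Definition sigma (n : nat) : nat := \sum_(d <- divisors n) d.

(* The division is exact, by [pfactor_dvdnn]. *)
Definition T (n : nat) : nat := sigma n %/ 2 ^ logn 2 (sigma n).

(* Ranging over [primes n] loses nothing: if [p] does not divide [n] then
   [logn p n = 0], which is even. *)
Definition omega_o (n : nat) : nat := count (fun p => odd (logn p n)) (primes n).

(* Here the restriction to [primes n] is needed, as [logn p n = 0] is even. *)
Definition E (n : nat) : rat :=
  (\prod_(p <- primes n | ~~ odd (logn p n)) (p%:R / (p%:R - 1)))%R.

(* Main.v *)
Require Import Defs.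
From mathcomp Require Import all_boot all_order all_algebra.
From mathcomp Require Import lra.
Import Order.TTheory GRing.Theory Num.Theory.

(** Since [2 ^ omega_o n] divides [sigma n], [T n / n] is at most
    [sigma n / (2 ^ omega_o n * n)], which is a product over the primes [p]
    dividing [n]. The factor at [p] is less than [p / (p - 1)] when the exponent
    is even, and less than [p / (2 * (p - 1)) <= 3 / 4] when it is odd. *)

(** Horner's scheme: each of the [e] iterations multiplies the current list by [p] and merges in
    [s], so a sum [t] becomes [p * t] plus the sum of [s]. *)
Lemma sumn_add_divisors (p e : nat) (s : seq nat) :
  \sum_(d <- PrimeDecompAux.add_divisors (p, e) s) d =
  (\sum_(i < e.+1) p ^ i) * \sum_(d <- s) d.
Proof.
rewrite /PrimeDecompAux.add_divisors.
elim: e => [|e IHe]; first by rewrite big_ord_recl big_ord0 mul1n.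
rewrite iterS; set t := iter e _ s in IHe *.
rewrite (perm_big _ (permEl (perm_merge leq _ s))) big_cat big_map /=.
under eq_bigr => d _ do rewrite NatTrec.mulE.
rewrite -big_distrr /= IHe [in RHS]big_ord_recl mulnDl mul1n addnC mulnA.
by congr (_ + _ * _); rewrite big_distrr; apply: eq_bigr => i _; rewrite expnS.
Qed.

(** [divisors n] is built by folding [add_divisors] over the prime decomposition, starting from
    [[:: 1]], so each prime power contributes its geometric sum as a factor. *)
Lemma sigma_prod (n : nat) :
  sigma n = \prod_(p <- primes n) \sum_(i < (logn p n).+1) p ^ i.
Proof.
rewrite /sigma /divisors prime_decompE; elim: (primes n) => [|p s IHs].
  by rewrite big_seq1 big_nil.
by rewrite /= sumn_add_divisors IHs big_cons.
Qed.

Lemma odd_sum_expn (p k : nat) : odd p -> odd (\sum_(i < k) p ^ i) = odd k.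
Proof.
move=> p_odd; elim: k => [|k IHk]; first by rewrite big_ord0.
by rewrite big_ord_recr oddD IHk oddX p_odd orbT addbT.
Qed.

Lemma odd_mem_primes (n p : nat) : odd n -> p \in primes n -> odd p.
Proof.
move=> n_odd; rewrite mem_primes => /and3P[_ _ p_dvd_n].
exact: dvdn_odd p_dvd_n n_odd.
Qed.

Lemma expn2_omega_o (n : nat) :
  2 ^ omega_o n = \prod_(p <- primes n) (if odd (logn p n) then 2 else 1).
Proof. by rewrite -big_mkcond big_const_seq iter_muln_1. Qed.

Lemma dvdn_expn2_omega_o (n : nat) : odd n -> 2 ^ omega_o n %| sigma n.
Proof.
move=> n_odd; rewrite expn2_omega_o sigma_prod big_seq [X in _ %| X]big_seq.
apply: (big_ind2 (fun a b => a %| b)) => // [a b c d|p p_n]; first exact: dvdn_mul.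
case: ifP => [e_odd|_]; last exact: dvd1n.
(* For an odd exponent the sum has an even number, [(logn p n).+1], of odd terms. *)
by rewrite dvdn2 odd_sum_expn /= ?negbK //; exact: odd_mem_primes n_odd p_n.
Qed.

Lemma sigma_gt0 (n : nat) : 0 < sigma n.
Proof.
rewrite sigma_prod; apply: prodn_gt0 => p.
by rewrite big_ord_recl.
Qed.

Lemma T_mul_expn2_omega_o (n : nat) : odd n -> T n * 2 ^ omega_o n <= sigma n.
Proof.
move=> n_odd.
rewrite -[leqRHS](divnK (pfactor_dvdnn 2 (sigma n))) leq_mul2l leq_exp2l //.
(* The divisibility says exactly that [omega_o n] is at most the 2-adic valuation of [sigma n]. *)
by rewrite -pfactor_dvdn ?sigma_gt0 ?dvdn_expn2_omega_o ?orbT.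
Qed.

Local Open Scope ring_scope.

(** After clearing denominators, this is [x ^+ a.+1 - 1 < x ^+ a.+1], by the geometric sum
    formula. *)
Lemma sum_expr_lt (F : numFieldType) (x : F) (a : nat) :
  1 < x -> (\sum_(i < a.+1) x ^+ i) / x ^+ a < x / (x - 1).
Proof.
move=> x_gt1; have x_gt0 : 0 < x := lt_trans ltr01 x_gt1.
rewrite ltr_pdivrMr ?exprn_gt0 // mulrAC -exprS ltr_pdivlMr ?subr_gt0 //.
by rewrite mulrC -subrX1 ltrBlDr ltrDl.
Qed.

(** Puts the bound in the form of a product over [primes n], to be compared factor by factor with
    that of [sigma_div_prod]. *)
Lemma omega_o_mul_E (n : nat) :
  (3%:R / 4%:R) ^+ omega_o n * E n =
  \prod_(p <- primes n) (if odd (logn p n) then 3%:R / 4%:R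
                         else p%:R / (p%:R - 1)) :> rat.
Proof.
rewrite (bigID (fun p => odd (logn p n))) /=; congr (_ * _).
  by rewrite -iter_mulr_1 -big_const_seq; apply: eq_bigr => p ->.
by apply: eq_bigr => p /negbTE->.
Qed.

Lemma sigma_div_prod (n : nat) : (0 < n)%N ->
  (sigma n)%:R / (2 ^ omega_o n)%:R / n%:R =
  \prod_(p <- primes n)
    ((\sum_(i < (logn p n).+1) p%:R ^+ i) / p%:R ^+ logn p n /
     (if odd (logn p n) then 2 else 1)) :> rat.
Proof.
move=> n_gt0; rewrite !prodf_div mulrAC; congr (_ / _ / _).
- rewrite sigma_prod natr_prod; apply: eq_bigr => p _.
  by rewrite natr_sum; apply: eq_bigr => i _; rewrite natrX.
- rewrite {1}(prod_prime_decomp n_gt0) prime_decompE big_map natr_prod.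
  by apply: eq_bigr => p _; rewrite natrX.
- by rewrite expn2_omega_o natr_prod; apply: eq_bigr => p _; case: ifP.
Qed.

Theorem theorem2p3 (n : nat) (n_gt1 : (1 < n)%N) (n_odd : odd n) :
  (2 ^ omega_o n %| sigma n)%N /\
  ((T n)%:R / n%:R < (3%:R / 4%:R) ^+ omega_o n * E n :> rat)%R.
Proof.
split; first exact: dvdn_expn2_omega_o.
have n_gt0 : (0 < n)%N := ltnW n_gt1.
apply: (@le_lt_trans _ _ ((sigma n)%:R / (2 ^ omega_o n)%:R / n%:R)).
  rewrite ler_pM2r ?invr_gt0 ?ltr0n // ler_pdivlMr ?ltr0n ?expn_gt0 //.
  by rewrite -natrM ler_nat T_mul_expn2_omega_o.
rewrite sigma_div_prod // omega_o_mul_E big_seq [ltRHS]big_seq.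
apply: ltr_prod => [|p p_n].
  (* A strict inequality of products needs at least one factor; [1 < n] provides the prime
     [pdiv n]. *)
  have pdiv_n : pdiv n \in primes n.
    by rewrite mem_primes pdiv_prime // n_gt0 pdiv_dvd.
  by apply/hasP; exists (pdiv n).
have p_ge3 : 3 <= p%:R :> rat.
  rewrite ler_nat; apply: odd_prime_gt2; first exact: odd_mem_primes n_odd p_n.
  by move: p_n; rewrite mem_primes => /andP[].
have := @sum_expr_lt rat p%:R (logn p n) ltac:(lra).
have : 0 <= (\sum_(i < (logn p n).+1) p%:R ^+ i) / p%:R ^+ logn p n :> rat.
  by rewrite divr_ge0 ?sumr_ge0 // => *; rewrite exprn_ge0 ?ler0n.
(* The value at [p = 3] is the largest, as [p / (p - 1)] decreases; halving it gives the constant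
   3/4. *)
have : p%:R / (p%:R - 1) <= 3 / 2 :> rat by rewrite ler_pdivrMr; lra.
set x := _ / _ ^+ _; set y := p%:R / _ => y_le x_ge0 x_lt.
by case: ifP => _; apply/andP; split; lra.
Qed.
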